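(* Let $E$ be a finite set and $\mathcal{L}$ a set of subsets of $E$ with $|\mathcal{L}|=n$, and suppose the toggle group $T(\mathcal{L})$ acts transitively on $\mathcal{L}$. If $T(\mathcal{L})$ contains a 3-cycle, then $T(\mathcal{L})$ contains the alternating group on $\mathcal{L}$ (i.e. $A_n\le T(\mathcal{L})$).
   Context: For $e\in E$, the toggle $\tau_e:\mathcal{L}\to\mathcal{L}$ is defined by $\tau_e(X)=X\triangle\{e\}$ if $X\triangle\{e\}\in\mathcal{L}$, and $\tau_e(X)=X$ otherwise. The toggle group $T(\mathcal{L})$ is the subgroup of the symmetric group on $\mathcal{L}$ generated by $\{\tau_e: e\in E\}$; its degree is $|\mathcal{L}|$. *)

(* Defs.v *)
From HB Require Import structures.
From mathcomp Require Import all_boot all_fingroup all_solvable.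

Set Implicit Arguments.
Unset Strict Implicit.
Unset Printing Implicit Defensive.

Import GroupScope.

Definition symdiff (T : finType) (A B : {set T}) : {set T} :=
  (A :\: B) :|: (B :\: A).

Section Toggle.
Variables (E : finType) (L : {set {set E}}).

(* The set L as a finite type, so that permutations of L are {perm member}. *)
Definition member : finType := {X : {set E} | X \in L}.

(* insubd X Y is Y when Y \in L, and X otherwise. *)
Definition toggle_fun (e : E) (X : member) : member :=
  insubd X (symdiff (val X) [set e]).

Lemma toggle_funK (e : E) : involutive (toggle_fun e).
Proof.
move=> X; apply: val_inj; rewrite /toggle_fun.
have symK : symdiff (symdiff (val X) [set e]) [set e] = val X.
  by apply/setP => x; rewrite !inE; case: (x == e); case: (x \in val X).
have [XeL | XeL] := boolP (symdiff (val X) [set e] \in L).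
  by rewrite !val_insubd XeL symK (valP X).
have -> : insubd X (symdiff (val X) [set e]) = X.
  by apply: val_inj; rewrite val_insubd (negbTE XeL).
by rewrite val_insubd (negbTE XeL).
Qed.

Definition toggle (e : E) : {perm member} := perm (inv_inj (toggle_funK e)).

Definition toggle_group : {group {perm member}} :=
  <<[set toggle e | e : E]>>%G.

End Toggle.

Definition is_3cycle (T : finType) (s : {perm T}) : Prop :=
  exists x y z : T,
    [/\ uniq [:: x; y; z], s x = y, s y = z, s z = x &
        forall t : T, t \notin [:: x; y; z] -> s t = t].

(* Main.v *)
Require Import Defs.
From HB Require Import structures.
From mathcomp Require Import all_boot all_fingroup all_solvable.

(** Call [x] and [y] linked when [x = y] or some 3-cycle of the group [G] moves
    [x] to [y].  This is a [G]-invariant equivalence, and if it is total then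
    [G] contains every 3-cycle, hence the alternating group.

    Suppose it is not total in a transitive toggle group, and let [c] be a
    3-cycle [x -> y -> z -> x].  Call [f] internal if [toggle f] moves some
    member to a linked one.  Comparing a class with its translate by a toggle
    that leaves it shows that an internal toggle preserves every class, so a
    non-internal toggle acts on each class either trivially or as a translation
    to another class.
    - For non-internal [e], whether [e] changes membership under [c] depends
      only on the class; since [c] has order 3, [x] and [y] agree at [e].
    - The equivalence generated by class-leaving toggles is [G]-invariant and
      preserves membership of internal [f].  Some [w] outside the class of [x]
      is so related to [x], and [c w = w], so [y] is related to [x], and [x]
      and [y] agree at [f].
    Thus [x = y], a contradiction. *)

Set Implicit Arguments.
Unset Strict Implicit.
Unset Printing Implicit Defensive.

Import GroupScope.

(** * 3-cycles as products of two transpositions *)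

Section ThreeCycles.
Variables (T : finType) (G : {group {perm T}}).

(* The permutation [x -> y -> z -> x] when [x], [y] and [z] are distinct. *)
Definition cycle3 (x y z : T) : {perm T} := tperm x y * tperm x z.

Lemma cycle3J (x y z : T) (g : {perm T}) :
  cycle3 x y z ^ g = cycle3 (g x) (g y) (g z).
Proof. by rewrite /cycle3 conjMg !tpermJ. Qed.

Lemma cycle3V (x y z : T) : (cycle3 x y z)^-1 = cycle3 x z y.
Proof. by rewrite /cycle3 invMg !tpermV. Qed.

Lemma cycle3_rot (x y z : T) :
  y != x -> y != z -> cycle3 x y z = cycle3 z x y.
Proof.
move=> yx yz; rewrite /cycle3 conjgC tpermJ tpermL tpermD 1?eq_sym //.
by rewrite [tperm x z]tpermC.
Qed.

Lemma cycle3E (x y z : T) : uniq [:: x; y; z] ->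
  [/\ cycle3 x y z x = y, cycle3 x y z y = z & cycle3 x y z z = x].
Proof.
rewrite /= !inE negb_or andbT => /andP[/andP[xy xz] yz].
rewrite /cycle3 !permM tpermL tpermR tpermL (@tpermD _ x y z) // tpermR.
by rewrite tpermD // eq_sym.
Qed.

Lemma is_3cycleP (s : {perm T}) : is_3cycle s ->
  exists x y z : T, uniq [:: x; y; z] /\ s = cycle3 x y z.
Proof.
move=> [x [y [z [U sx sy sz sD]]]]; exists x, y, z; split=> //.
have [cx cy cz] := cycle3E U; apply/permP=> t.
have [|tD] := boolP (t \in [:: x; y; z]).
  by rewrite !inE => /or3P[] /eqP->; congruence.
rewrite sD //; move: tD; rewrite !inE !negb_or => /and3P[tx ty tz].
by rewrite /cycle3 permM !tpermD // eq_sym.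
Qed.

(** * Points joined by a 3-cycle of the group *)

Definition linked (x y : T) : bool :=
  (x == y) || [exists z, uniq [:: x; y; z] && (cycle3 x y z \in G)].

Lemma linkedP (x y : T) :
  reflect (x = y \/ exists2 z, uniq [:: x; y; z] & cycle3 x y z \in G)
          (linked x y).
Proof.
apply: (iffP orP) => [[/eqP|/existsP[z /andP[]]]|[->|[z U cG]]]; first by left.
- by right; exists z.
- by left.
- by right; apply/existsP; exists z; rewrite U.
Qed.

Lemma linked_refl : reflexive linked.
Proof. by move=> x; apply/linkedP; left. Qed.

Lemma linked_cycle3 (x y z : T) :
  uniq [:: x; y; z] -> cycle3 x y z \in G -> linked x y.
Proof. by move=> U cG; apply/linkedP; right; exists z. Qed.

Lemma uniq3_rot (x y z : T) : uniq [:: x; y; z] -> uniq [:: z; x; y].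
Proof. by rewrite -(rot_uniq 2). Qed.

Lemma cycle3_rot_in (x y z : T) :
  uniq [:: x; y; z] -> cycle3 x y z \in G -> cycle3 z x y \in G.
Proof.
move=> U cG; rewrite -cycle3_rot //; move: U; rewrite /= !inE negb_or.
  by rewrite eq_sym; case/and3P=> /andP[].
by case/and3P.
Qed.

Lemma linked_sym : symmetric linked.
Proof.
suff sub x y : linked x y -> linked y x by move=> x y; apply/idP/idP; apply: sub.
case/linkedP=> [->|[z U cG]]; first exact: linked_refl.
have V : uniq [:: x; z; y].
  move: U; rewrite /= !inE !negb_or (eq_sym y z) !andbT.
  by case/andP=> /andP[-> ->] ->.
apply: (linked_cycle3 (uniq3_rot V)); apply: cycle3_rot_in V _.
by rewrite -cycle3V groupV.
Qed.

(** When [w] is off the cycle [c], conjugating [cycle3 y w u] by [c^-1] replaces [y] by [x] and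
    keeps [w]. *)
Lemma linked_trans : transitive linked.
Proof.
move=> y x w /linkedP[->//|[z U cG]] /linkedP[<-|[u V dG]].
  exact: linked_cycle3 U cG.
have [->|wx] := eqVneq w x; first exact: linked_refl.
have [->|wz] := eqVneq w z.
  by rewrite linked_sym; apply: linked_cycle3 (uniq3_rot U) (cycle3_rot_in U cG).
have [cx cy cz] := cycle3E U; set c := cycle3 x y z in cG cx cy cz.
have wy : w != y by move: V; rewrite /= inE negb_or eq_sym; case/andP=> /andP[].
have cVy : c^-1 y = x by rewrite -cx permK.
have cVw : c^-1 w = w.
  apply: (canLR (permK c)).
  by rewrite /c /cycle3 permM !tpermD // eq_sym.
apply: (@linked_cycle3 _ _ (c^-1 u)).
  have : uniq (map (c^-1) [:: y; w; u]) by rewrite map_inj_uniq //; apply: perm_inj.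
  by rewrite [map _ _]/= cVy cVw.
have -> : cycle3 x w (c^-1 u) = cycle3 y w u ^ c^-1 by rewrite cycle3J cVy cVw.
by rewrite groupJ ?groupV.
Qed.

Lemma linked_perm (g : {perm T}) (x y : T) :
  g \in G -> linked (g x) (g y) = linked x y.
Proof.
suff sub (h : {perm T}) a b : h \in G -> linked a b -> linked (h a) (h b).
  move=> gG; apply/idP/idP; last exact: sub.
  by move/(sub g^-1); rewrite groupV !permK; apply.
move=> hG /linkedP[->|[z U cG]]; first exact: linked_refl.
apply: (@linked_cycle3 _ _ (h z)); last by rewrite -cycle3J groupJ.
have : uniq (map h [:: a; b; z]) by rewrite map_inj_uniq //; apply: perm_inj.
by [].
Qed.

(** Some 3-cycle [a -> b -> z] lies in [G]; conjugation by a 3-cycle [z -> c -> u] of [G] replaces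
    [z] by [c]. *)
Lemma linked_total_cycle3 (a b c : T) :
  (forall x y, linked x y) -> a != b -> a != c -> cycle3 a b c \in G.
Proof.
move=> tot ab ac; have [<-|bc] := eqVneq b c.
  by rewrite /cycle3 tperm2 group1.
case/linkedP: (tot a b) => [/eqP|[z U kG]]; first by rewrite (negPf ab).
have [<-//|zc] := eqVneq z c.
case/linkedP: (tot z c) => [/eqP|[u V mG]]; first by rewrite (negPf zc).
move: (U); rewrite /= !inE negb_or !andbT => /andP[/andP[_ az] bz].
have [mz mc mu] := cycle3E V; have mE := fun t => permM (tperm z c) (tperm z u) t.
set m := cycle3 z c u in mG mz mc mu mE.
have mVc : m^-1 z = u by rewrite -mu permK.
have mVu : m^-1 u = c by rewrite -mc permK.
have fixm t : t != z -> t != c -> t != u -> m t = t.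
  by move=> tz tc tu; rewrite mE !tpermD // eq_sym.
have fixmV t : t != z -> t != c -> t != u -> m^-1 t = t.
  by move=> tz tc tu; apply: (canLR (permK m)); rewrite fixm.
(* [m] moves [u], so if [u] is [a] or [b], conjugation by [m^-1] is used instead; up to rotation it
   gives the inverse of the wanted cycle. *)
have [ua|ua] := eqVneq a u.
  have : cycle3 a b z ^ m^-1 \in G by rewrite groupJ ?groupV.
  rewrite cycle3J mVc [in m^-1 a]ua mVu fixmV -?ua //; last by rewrite eq_sym.
  move=> cG; rewrite cycle3_rot // 1?eq_sym //.
  by rewrite -groupV cycle3V.
have [ub|ub] := eqVneq b u.
  have : cycle3 a b z ^ m^-1 \in G by rewrite groupJ ?groupV.
  rewrite cycle3J mVc [in m^-1 b]ub mVu fixmV -?ub // => cG.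
  by rewrite -groupV cycle3V.
have : cycle3 a b z ^ m \in G by rewrite groupJ.
by rewrite cycle3J mz !fixm.
Qed.

Lemma linked_total_Alt : (forall x y, linked x y) -> 'Alt_T \subset G.
Proof.
move=> tot; apply/subsetP=> s; rewrite Alt_even.
have [ts -> dts] := prod_tpermP s.
have pairG a b c d : a != b -> c != d -> tperm a b * tperm c d \in G.
  move=> ab cd; have [ac|ac] := eqVneq a c.
    by rewrite -ac in cd *; apply: linked_total_cycle3.
  (* Inserting [tperm a c] twice leaves two products of transpositions sharing a point. *)
  rewrite -[tperm a b](mulgK (tperm a c)) -mulgA tpermV.
  apply: groupM; first exact: linked_total_cycle3.
  by rewrite tpermC; apply: linked_total_cycle3 => //; rewrite eq_sym.
rewrite odd_perm_prod //.
have [n] := ubnP (size ts); elim: n ts dts => // n IHn [|t [|t' ts]] //=.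
  by rewrite big_nil group1.
case/and3P=> dt dt' dts lts; rewrite negbK => ev.
rewrite !big_cons mulgA groupM //; first exact: pairG.
by apply: IHn => //; rewrite -ltnS ltnW.
Qed.

End ThreeCycles.

(** * Toggles acting on members and on blocks *)

Section ToggleBlocks.
Variables (E : finType) (L : {set {set E}}).
Implicit Types (X Y : member L) (e f h : E) (g : {perm member L}).

Lemma toggleK e : involutive (toggle L e).
Proof. by move=> X; rewrite !permE toggle_funK. Qed.

Lemma val_toggle e X :
  val (toggle L e X) = if symdiff (val X) [set e] \in L
                       then symdiff (val X) [set e] else val X.
Proof. by rewrite permE val_insubd. Qed.

Lemma val_toggle_moved e X :
  toggle L e X != X -> val (toggle L e X) = symdiff (val X) [set e].
Proof. by rewrite -val_eqE /= val_toggle; case: ifP => //; rewrite eqxx. Qed.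

Lemma in_toggle f e X :
  (f \in val (toggle L e X)) =
  (f \in val X) (+) ((f == e) && (toggle L e X != X)).
Proof.
have [->|mv] := eqVneq (toggle L e X) X; first by rewrite andbF addbF.
by rewrite val_toggle_moved // !inE andbT; case: (f == e); case: (f \in _).
Qed.

Lemma symdiffAC (A B C : {set E}) :
  symdiff (symdiff A B) C = symdiff (symdiff A C) B.
Proof.
by apply/setP=> x; rewrite !inE; case: (x \in A); case: (x \in B); case: (x \in C).
Qed.

(** The hypotheses put both flips of [X] and their composite in [L], so the square of flips closes
    up. *)
Lemma toggle_square e h X :
    toggle L e X != X -> toggle L h X != X ->
    toggle L e (toggle L h X) != toggle L h X ->
  toggle L h (toggle L e X) = toggle L e (toggle L h X).
Proof.
move=> /val_toggle_moved eX /val_toggle_moved hX /val_toggle_moved ehX.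
apply: val_inj; rewrite val_toggle eX symdiffAC -hX -ehX.
by rewrite (valP (toggle L e (toggle L h X))).
Qed.

Lemma toggle_in e : toggle L e \in toggle_group L.
Proof. by apply/mem_gen/imsetP; exists e. Qed.

Lemma toggle_group_ind (P : {perm member L} -> Prop) :
    P 1 -> (forall g e, g \in toggle_group L -> P g -> P (g * toggle L e)) ->
  forall g, g \in toggle_group L -> P g.
Proof.
move=> P1 PM g /gen_prodgP[n [c cP ->]].
suff [] : P (\prod_(i < n) c i) /\ \prod_(i < n) c i \in toggle_group L by [].
elim: n c cP => [|n IHn] c cP; first by rewrite big_ord0 group1.
rewrite big_ord_recr /=; have [|Pn Gn] := IHn (fun i => c (widen_ord (leqnSn n) i)).
  by move=> i; apply: cP.
have /imsetP[e _ ->] := cP ord_max.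
by split; [apply: PM | rewrite groupM ?toggle_in].
Qed.

Hypothesis trans_L : [transitive (toggle_group L), on [set: member L] | 'P].

(** An arbitrary invariant equivalence, instantiated by [linked] at the end. *)
Variable R : rel (member L).
Hypotheses (R_refl : reflexive R) (R_sym : symmetric R) (R_trans : transitive R).
Hypothesis R_perm : forall g X Y, g \in toggle_group L -> R (g X) (g Y) = R X Y.

Let R_toggle e X Y : R (toggle L e X) (toggle L e Y) = R X Y.
Proof. exact/R_perm/toggle_in. Qed.

Lemma toggle_stable_total (P : member L -> Prop) X Y :
  (forall h Z, P Z -> P (toggle L h Z)) -> P X -> P Y.
Proof.
move=> Ph PX; have /(atransP2 trans_L)/(_ (in_setT Y))[g gG ->] := in_setT X.
rewrite /= /aperm; elim/toggle_group_ind: g / gG => [|g e _ Pg]; first by rewrite perm1.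
by rewrite permM; apply: Ph.
Qed.

(** * Toggles within classes and across classes *)

Definition internal f : bool :=
  [exists X, (toggle L f X != X) && R (toggle L f X) X].

Definition leaves e X : bool := ~~ R (toggle L e X) X.

Lemma leaves_moved e X : leaves e X -> toggle L e X != X.
Proof. by apply: contraNneq => ->. Qed.

Lemma leaves_class e X Y : R X Y -> leaves e X = leaves e Y.
Proof.
move=> RXY; have ReXY : R (toggle L e X) (toggle L e Y) by rewrite R_toggle.
congr (~~ _); apply/idP/idP=> H.
  by apply: (R_trans _ RXY); apply: R_trans H; rewrite R_sym.
by apply: (R_trans ReXY); apply: (R_trans H); rewrite R_sym.
Qed.

Lemma internal_class f X : internal f -> R (toggle L f X) X.
Proof.
case/existsP=> X0 /andP[mv0 R0].
(* [P] depends only on the class of [X]. A toggle [h] leaving the class carries the witness [Y]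
   along, by the square on [Y], so transitivity spreads [P] to all members. *)
pose P X := exists Y, [/\ R Y X, toggle L f Y != Y & R (toggle L f Y) Y].
have : P X.
  apply: (@toggle_stable_total P X0); last by exists X0.
  move=> h Z [Y [RYZ mvY RY]].
  have [lvZ|] := boolP (leaves h Z); last first.
    rewrite negbK => RhZ; exists Y; split=> //.
    by apply: (R_trans RYZ); rewrite R_sym.
  have lvY : leaves h Y by rewrite (leaves_class h RYZ).
  have lvfY : leaves h (toggle L f Y) by rewrite (leaves_class h RY).
  have sq := toggle_square (leaves_moved lvY) mvY (leaves_moved lvfY).
  exists (toggle L h Y); rewrite sq !R_toggle (inj_eq perm_inj).
  by split.
move=> [Y [RYX _ RfY]]; apply: R_trans (RYX); apply: R_trans RfY.
by rewrite R_toggle R_sym.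
Qed.

Lemma leaves_not_internal e X : leaves e X -> ~~ internal e.
Proof. by apply: contra => /internal_class. Qed.

Lemma not_internal_leaves e X : ~~ internal e -> leaves e X = (toggle L e X != X).
Proof.
move=> nI; apply/idP/idP=> [|mv]; first exact: leaves_moved.
by apply: contra nI => RX; apply/existsP; exists X; rewrite mv.
Qed.

Lemma internal_leaves_comm e h X : internal h -> leaves e X ->
  toggle L h (toggle L e X) = toggle L e (toggle L h X).
Proof.
move=> hI lvX; have lvhX : leaves e (toggle L h X).
  by rewrite (leaves_class e (internal_class X hI)).
have [hX|mv] := eqVneq (toggle L h X) X; last first.
  by apply: toggle_square => //; apply: leaves_moved.
rewrite hX; set Y := toggle L e X.
have eY : toggle L e Y = X by rewrite toggleK.
have [//|mvY] := eqVneq (toggle L h Y) Y.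
have lvY : leaves e Y by rewrite /leaves eY R_sym.
have lvhY : leaves e (toggle L h Y).
  by rewrite (leaves_class e (internal_class Y hI)).
(* The square at [Y] gives [X = toggle L e (toggle L h Y)], so [h] fixes [Y] after all. *)
have := toggle_square (leaves_moved lvY) mvY (leaves_moved lvhY).
by rewrite eY hX => XE; rewrite [in RHS]/Y XE toggleK.
Qed.

(** * The equivalence generated by class-leaving toggles *)

Definition exit_step : rel (member L) :=
  [rel X Y | [exists e, leaves e X && (Y == toggle L e X)]].

Lemma exit_stepT e X : leaves e X -> exit_step X (toggle L e X).
Proof. by move=> lvX; apply/existsP; exists e; rewrite lvX eqxx. Qed.

Lemma exit_step_sym : symmetric exit_step.
Proof.
suff sub X Y : exit_step X Y -> exit_step Y X.
  by move=> X Y; apply/idP/idP; apply: sub.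
case/existsP=> e /andP[lvX /eqP->]; rewrite -[X in exit_step _ X](toggleK e).
by apply: exit_stepT; rewrite /leaves toggleK R_sym.
Qed.

(** An internal toggle commutes with exit steps; any other toggle fixes a member or moves it by an
    exit step. *)
Lemma exit_connect_perm g X Y : g \in toggle_group L ->
  connect exit_step X Y -> connect exit_step (g X) (g Y).
Proof.
move=> gG; elim/toggle_group_ind: g / gG X Y => [|g h _ IHg] X Y.
  by rewrite !perm1.
move/IHg; rewrite !permM; move: (g X) (g Y) => {g IHg}X {}Y.
case/connectP=> p; elim: p X => [|Z p IHp] X /= => [_ ->//|/andP[XZ pZ] lastY].
apply: connect_trans (IHp Z pZ lastY).
have [hI|hI] := boolP (internal h).
  case/existsP: XZ => e /andP[lvX /eqP->].
  rewrite internal_leaves_comm //; apply/connect1/exit_stepT.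
  by rewrite (leaves_class e (internal_class X hI)).
have step W : connect exit_step W (toggle L h W).
  have [->//|mv] := eqVneq (toggle L h W) W.
  by apply/connect1/exit_stepT; rewrite not_internal_leaves.
rewrite (connect_trans _ (step Z)) // (connect_trans _ (connect1 XZ)) //.
by rewrite (sym_connect_sym exit_step_sym).
Qed.

Lemma exit_connect_internal f X Y : internal f ->
  connect exit_step X Y -> (f \in val X) = (f \in val Y).
Proof.
move=> fI /connectP[p]; elim: p X => [|Z p IHp] X /= => [_ ->//|/andP[XZ pZ] lastY].
rewrite -(IHp Z) //; case/existsP: XZ => e /andP[lvX /eqP->].
rewrite in_toggle; have [fe|] := eqVneq f e; last by rewrite addbF.
by have := leaves_not_internal lvX; rewrite -fe fI.
Qed.

(** Write [g] as a word in toggles: each side is the parity of the times [toggle L e] really moves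
    the member, which depends only on the class. *)
Lemma not_internal_change e g X Y : ~~ internal e -> g \in toggle_group L ->
  R X Y ->
  (e \in val (g X)) (+) (e \in val X) = (e \in val (g Y)) (+) (e \in val Y).
Proof.
move=> eI gG RXY; elim/toggle_group_ind: g / gG => [|g h gG IHg].
  by rewrite !perm1 !addbb.
rewrite !permM !in_toggle addbAC IHg [RHS]addbAC; congr (_ (+) _).
have [<-|//] := eqVneq e h; rewrite -!not_internal_leaves //.
by apply: leaves_class; rewrite R_perm.
Qed.

Lemma class_not_closed X Y : ~~ R X Y -> exists e, leaves e X.
Proof.
move=> nRXY; apply/existsP; apply: contraR nRXY => /existsPn stay.
apply: (@toggle_stable_total (R X) X) => // h Z RXZ.
apply: (R_trans RXZ); rewrite R_sym -[R _ _]negbK -/(leaves h Z).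
by rewrite -(leaves_class h RXZ).
Qed.

Lemma toggle_3cycle_fixed c x y z w :
    c \in toggle_group L -> c x = y -> c y = z -> c z = x ->
    R x y -> R x z -> (forall t, ~~ R t x -> c t = t) ->
  ~~ R x w -> x = y.
Proof.
move=> cG cx cy cz Rxy Rxz cD /class_not_closed[e lvx].
have con := connect1 (exit_stepT lvx).
(* [c] fixes [toggle L e x], which is outside the class, so [y = c x] is also connected to it. *)
have xy : connect exit_step y x.
  have := exit_connect_perm cG con; rewrite cx cD // => /connect_trans; apply.
  by rewrite (sym_connect_sym exit_step_sym).
apply/val_inj/setP=> f; have [fI|fI] := boolP (internal f).
  by rewrite (exit_connect_internal fI xy).
(* The three changes around the cycle are equal bits with sum zero; three being odd, each is
   zero. *)
have := not_internal_change fI cG Rxy; have := not_internal_change fI cG Rxz.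
rewrite cx cy cz.
by case: (f \in val x); case: (f \in val y); case: (f \in val z).
Qed.

End ToggleBlocks.

(** * From one 3-cycle to the alternating group *)

Theorem theorem3p2 (E : finType) (L : {set {set E}}) (n : nat)
    (card_L : #|L| = n)
    (trans_L : [transitive (toggle_group L), on [set: member L] | 'P])
    (has_3cycle : exists2 s : {perm (member L)},
                    s \in toggle_group L & is_3cycle s) :
  ('Alt_(member L))%g \subset toggle_group L.
Proof.
have [c cG /is_3cycleP[x [y [z [U cE]]]]] := has_3cycle; rewrite {}cE in cG.
have [cx cy cz] := cycle3E U.
have Rxy := linked_cycle3 U cG.
have Rxz : linked (toggle_group L) x z.
  by rewrite linked_sym; apply: linked_cycle3 (uniq3_rot U) (cycle3_rot_in U cG).
apply: linked_total_Alt.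
suff tot w : linked (toggle_group L) x w.
  move=> a b; apply: linked_trans (tot b).
  by rewrite linked_sym; apply: tot.
apply/negPn/negP=> nRxw.
suff xy : x = y by move: U; rewrite xy /= inE eqxx.
apply: (toggle_3cycle_fixed trans_L (@linked_refl _ _) (@linked_sym _ _)
  (@linked_trans _ _) _ cG cx cy cz Rxy Rxz _ nRxw).
  by move=> g X Y; apply: linked_perm.
(* A member not linked to [x] differs from [x], [y] and [z], so the cycle fixes it. *)
move=> t nRtx; rewrite /cycle3 permM.
by rewrite !tpermD //; apply: contraNneq nRtx => <-; rewrite 1?linked_sym ?linked_refl.
Qed.
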